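(* Let $1\le k\le n$ and let $X_1,\ldots,X_n,Z$ be random variables with an arbitrary joint discrete distribution, taking only non-negative integers as values. Let $F_i(x)=P(X_i\le x)$, $\bar F_i(x)=P(X_i>x)$, $p_i(x)=P(X_i=x)$, $F_i(x^-)=P(X_i<x)$ and $\bar G(x)=P(Z>x)$. Let $T=\min(X_{n-k+1:n}+Z,\,X_{n-k+2:n})$ be the lifetime of the $k$-out-of-$n$ system with one cold standby unit. Then for $t=0,1,2,\ldots$ $$P(T>t)=\sum_{v=0}^{n-k}\ \sum_{(j_1,\ldots,j_n)\in\mathcal P_{v,n-k+1}}\ \sum_{u=0}^{t}P\big(A^{u,t}_{v}(j_1,\ldots,j_n)\big)+\sum_{v=0}^{n-k}\ \sum_{(j_1,\ldots,j_n)\in\mathcal P_v}P\big(C^{t}_{v}(j_1,\ldots,j_n)\big).$$ Furthermore: (i) if $X_1,\ldots,X_n,Z$ are independent, then $$P(T>t)=\sum_{v=0}^{n-k}\Bigg\{\sum_{(j_1,\ldots,j_n)\in\mathcal P_{v,n-k+1}}\Big(\prod_{\ell=n-k+2}^{n}\bar F_{j_\ell}(t)\Big)\sum_{u=0}^{t}\Big(\prod_{\ell=1}^{v}F_{j_\ell}(u^-)\Big)\Big(\prod_{\ell=v+1}^{n-k+1}p_{j_\ell}(u)\Big)\bar G(t-u)+\sum_{(j_1,\ldots,j_n)\in\mathcal P_v}\Big(\prod_{\ell=1}^{v}F_{j_\ell}(t)\Big)\Big(\prod_{\ell=v+1}^{n}\bar F_{j_\ell}(t)\Big)\Bigg\};$$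 (ii) if the random vector $(X_1,\ldots,X_n,Z)$ is exchangeable, then $$P(T>t)=n!\sum_{v=0}^{n-k}\frac1{v!}\Bigg\{\frac{1}{(n-k+1-v)!\,(k-1)!}\sum_{u=0}^{t}P\big(A^{u,t}_{v}(1,\ldots,n)\big)+\frac1{(n-v)!}P\big(C^{t}_{v}(1,\ldots,n)\big)\Bigg\};$$ (iii) if $(X_1,\ldots,X_n)$ and $Z$ are independent and $X_1,\ldots,X_n$ are independent and identically distributed with $F(x)=P(X_i\le x)$, $\bar F(x)=P(X_i>x)$, $F(x^-)=P(X_i<x)$, $p(x)=P(X_i=x)$, then $$P(T>t)=n!\sum_{v=0}^{n-k}\frac1{v!}\Bigg\{\frac{(\bar F(t))^{k-1}}{(n-k+1-v)!\,(k-1)!}\sum_{u=0}^{t}(F(u^-))^{v}(p(u))^{n-k+1-v}\,\bar G(t-u)+\frac{1}{(n-v)!}(F(t))^{v}(\bar F(t))^{n-v}\Bigg\}.$$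
   Context: $X_{1:n}\le\cdots\le X_{n:n}$ are the order statistics of $X_1,\ldots,X_n$ (lifetimes of the active components), and $X_{n+1:n}:=\infty$, so that $T=X_{n:n}+Z$ when $k=1$. $Z$ is the lifetime of the standby unit. For $0\le r\le n$, $\mathcal P_r$ is the set of permutations $(j_1,\ldots,j_n)$ of $(1,\ldots,n)$ with $j_1<\cdots<j_r$ and $j_{r+1}<\cdots<j_n$. For $0\le r<s\le n$, $\mathcal P_{r,s}$ is the set of permutations with $j_1<\cdots<j_r$, $j_{r+1}<\cdots<j_s$ and $j_{s+1}<\cdots<j_n$. The events are $$A^{u,t}_{v}(j_1,\ldots,j_n)=\bigcap_{\ell=1}^{v}\{X_{j_\ell}<u\}\cap\bigcap_{\ell=v+1}^{n-k+1}\{X_{j_\ell}=u\}\cap\bigcap_{\ell=n-k+2}^{n}\{X_{j_\ell}>t\}\cap\{Z>t-u\},$$ $$C^{t}_{v}(j_1,\ldots,j_n)=\bigcap_{\ell=1}^{v}\{X_{j_\ell}\le t\}\cap\bigcap_{\ell=v+1}^{n}\{X_{j_\ell}>t\}.$$ Conventions: empty sums are $0$, empty products are $1$ (so $0^0=1$), and empty intersections are the whole sample space. A random vector is exchangeable if every permutation of it has the same distribution. *)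

(* Defs.v *)
From HB Require Import structures.
From mathcomp Require Export all_boot all_order all_algebra all_fingroup.
From mathcomp Require Export all_classical all_reals all_analysis.

Set Implicit Arguments.
Unset Strict Implicit.
Unset Printing Implicit Defensive.

Local Open Scope classical_set_scope.
Local Open Scope ring_scope.

(* Indices are 0-based: the arrangement (j_1, ..., j_n) is the permutation
   j : 'S_n with j_(l+1) = (j l) + 1, and a range l = a+1, ..., b of 1-based
   positions becomes (a <= l < b)%N. *)

Definition increasing_between (n : nat) (j : 'S_n) (a b : nat) : bool :=
  [forall l : 'I_n, forall m : 'I_n,
     [&& a <= l, l < m & m < b]%N ==> (j l < j m)%N].

(* perms2 r is P_r and perms3 r s is P_{r,s}. *)
Definition perms2 (n r : nat) : pred 'S_n := fun j =>
  increasing_between j 0 r && increasing_between j r n.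

Definition perms3 (n r s : nat) : pred 'S_n := fun j =>
  [&& increasing_between j 0 r, increasing_between j r s
    & increasing_between j s n].

Section prob.
Context (d : measure_display) (Omega : measurableType d) (R : realType)
  (P : probability Omega R).

(* No information is lost by fine: a probability is always finite. *)
Definition Pr (A : set Omega) : R := fine (P A).

Definition F_le (X : {RV P >-> nat}) (x : nat) : R :=
  Pr [set w | (X w <= x)%N].
Definition F_lt (X : {RV P >-> nat}) (x : nat) : R :=
  Pr [set w | (X w < x)%N].
Definition F_gt (X : {RV P >-> nat}) (x : nat) : R :=
  Pr [set w | (x < X w)%N].
Definition p_eq (X : {RV P >-> nat}) (x : nat) : R :=
  Pr [set w | X w = x].

Definition mutually_independent (d' : measure_display) (S : measurableType d')
    (I : finType) (Y : I -> {RV P >-> S}) : Prop :=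
  forall (J : {set I}) (B : I -> set S),
    (forall i, i \in J -> measurable (B i)) ->
    Pr (\bigcap_(i in [set i | i \in J]) (Y i @^-1` B i)) =
    \prod_(i in J) Pr (Y i @^-1` B i).

Definition independent2 (d1 d2 : measure_display) (S1 : measurableType d1)
    (S2 : measurableType d2) (U : Omega -> S1) (V : Omega -> S2) : Prop :=
  forall (A : set S1) (B : set S2), measurable A -> measurable B ->
    Pr (U @^-1` A `&` V @^-1` B) = Pr (U @^-1` A) * Pr (V @^-1` B).

Definition same_distribution (d' : measure_display) (S : measurableType d')
    (U V : Omega -> S) : Prop :=
  forall B : set S, measurable B -> pushforward P U B = pushforward P V B.

Definition random_vector (m : nat) (Y : 'I_m -> {RV P >-> nat}) (w : Omega) :
  m.-tuple nat := [tuple Y i w | i < m].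

Definition exchangeable (m : nat) (Y : 'I_m -> {RV P >-> nat}) : Prop :=
  forall s : 'S_m,
    same_distribution (random_vector (fun i => Y (s i))) (random_vector Y).

Section system.
Context (n : nat) (X : 'I_n -> {RV P >-> nat}) (Z : {RV P >-> nat}).

(* (X_1, ..., X_n, Z) *)
Definition with_standby (i : 'I_n.+1) : {RV P >-> nat} :=
  if unlift ord_max i is Some l then X l else Z.

(* X_{r:n}, the r-th smallest value for 1 <= r <= n; it is oo for r = n + 1. *)
Definition order_stat (r : nat) (w : Omega) : \bar R :=
  if (r <= n)%N
  then (nth 0%N (sort leq [seq X i w | i <- enum 'I_n]) r.-1)%:R%:E
  else +oo%E.

Definition lifetime (k : nat) (w : Omega) : \bar R :=
  Order.min (order_stat (n - k + 1) w + (Z w)%:R%:E)%E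
            (order_stat (n - k + 2) w).

(* The truncated difference t - u is only used with u <= t. *)
Definition event_A (k v u t : nat) (j : 'S_n) : set Omega :=
  (\bigcap_(l in [set l : 'I_n | (l < v)%N]) [set w | (X (j l) w < u)%N])
  `&` (\bigcap_(l in [set l : 'I_n | (v <= l < n - k + 1)%N])
         [set w | X (j l) w = u])
  `&` (\bigcap_(l in [set l : 'I_n | (n - k + 1 <= l)%N])
         [set w | (t < X (j l) w)%N])
  `&` [set w | (t - u < Z w)%N].

Definition event_C (v t : nat) (j : 'S_n) : set Omega :=
  (\bigcap_(l in [set l : 'I_n | (l < v)%N]) [set w | (X (j l) w <= t)%N])
  `&` (\bigcap_(l in [set l : 'I_n | (v <= l)%N])
         [set w | (t < X (j l) w)%N]).

End system.
End prob.

(* Main.v *)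
Require Import Defs.
From mathcomp Require Import zify ring.

(* Let m = n - k + 1 and let N(u) be the number of components with X_i <= u.
   The system survives t iff N(t) < m, or N(t) = m and the spare started at
   u = X_{m:n} <= t outlives t - u.  The first case is the union of the events
   C, with v = N(t); the second is the union of the events A, with v the number
   of components failing strictly before u.  In each case the arrangement j is
   the unique one sorting the components by colour (failed before u, failed at
   u, alive at t) and by index inside each colour, so the unions are disjoint
   and additivity gives the general formula.  Under exchangeability the
   probabilities do not depend on j, and there are n!/(v!(s-v)!(n-s)!)
   arrangements in P_{v,s}. *)

Set Implicit Arguments.
Unset Strict Implicit.
Unset Printing Implicit Defensive.

(** * Permutations with increasing blocks: existence, uniqueness and number *)

Section arrangements.
Context (n : nat).
Implicit Types (c h : 'I_n -> nat) (j : 'S_n).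

(* The 0-based block, among [0, v[, [v, s[ and [s, n[, of the position l. *)
Definition position_colour (v s : nat) (l : 'I_n) : nat := (v <= l) + (s <= l).

Lemma card_ord_ltn m : m <= n -> #|[pred l : 'I_n | l < m]| = m.
Proof.
move=> mn; rewrite -sum1_card (eq_bigl (fun l : 'I_n => l < m)) //.
by rewrite (big_ord_narrow mn) sum1_card card_ord.
Qed.

Lemma card_perm_comp c j a :
  #|[pred l | c (j l) <= a]| = #|[pred i | c i <= a]|.
Proof.
rewrite -!sum1_card [RHS](reindex_inj (@perm_inj _ j)) /=.
by apply: eq_bigl => l; rewrite !inE.
Qed.

(** A sublevel set of a nondecreasing function on positions is an initial segment, hence determined
    by its size. *)
Lemma nondecreasing_leq_card h : {homo h : l m / l <= m} ->
  forall l a, (h l <= a) = (l < #|[pred l' | h l' <= a]|).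
Proof.
move=> hh l a; apply/idP/idP => [hla | ].
  rewrite -[l.+1](card_ord_ltn (ltn_ord l)); apply: subset_leq_card.
  by apply/fintype.subsetP => m; rewrite !inE ltnS => /hh /leq_trans; apply.
apply: contraTT; rewrite -ltnNge -leqNgt => ahl.
rewrite -[leqRHS](card_ord_ltn (ltnW (ltn_ord l))); apply: subset_leq_card.
apply/fintype.subsetP => m; rewrite !inE => hma.
by rewrite ltnNge; apply/negP => /hh; lia.
Qed.

(** Reindexing by [j] turns the indices with key below [K (j l)] into the positions below [l]. So
    the position of an index depends on [K] alone, which gives uniqueness of the sorting
    permutation. *)
Lemma perm_rank (K : 'I_n -> nat) j : {homo K \o j : l m / l < m} ->
  forall l, #|[pred i | K i < K (j l)]| = l.
Proof.
move=> Kj l; rewrite -[RHS](card_ord_ltn (ltnW (ltn_ord l))) -!sum1_card.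
rewrite (reindex_inj (@perm_inj _ j)) /=; apply: eq_bigl => m; rewrite !inE.
case: (ltngtP m l) => [/Kj //| /Kj /= | /val_inj ->]; lia.
Qed.

(** The rank, the number of smaller keys, is an injection of ['I_n] into itself; the inverse of the
    resulting permutation lists the indices by increasing key. *)
Lemma sorting_perm (K : 'I_n -> nat) : injective K ->
  exists j, {homo K \o j : l m / l < m}.
Proof.
move=> Kinj; pose r i := #|[pred i' | K i' < K i]|.
have r_lt i : r i < n.
  rewrite -[n in _ < n]card_ord; apply: proper_card; apply/properP.
  by split; [apply/fintype.subsetP | exists i; rewrite // inE ltnn].
have r_mono i i' : K i < K i' -> r i < r i'.
  move=> lt_ii'; apply: proper_card; apply/properP; split.
    by apply/fintype.subsetP => x; rewrite !inE => /ltn_trans; apply.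
  by exists i; rewrite !inE ?ltnn.
pose R i := Ordinal (r_lt i).
have Rinj : injective R.
  move=> i i' [] e.
  by case: (ltngtP (K i) (K i')) => [/r_mono|/r_mono|/Kinj //]; lia.
exists (perm Rinj)^-1%g => l m lm /=; rewrite ltnNge leq_eqVlt negb_or.
set a := _ m; set b := _ l.
have ra : r a = m.
  by have := permKV (perm Rinj) m; rewrite permE => /(congr1 val).
have rb : r b = l.
  by have := permKV (perm Rinj) l; rewrite permE => /(congr1 val).
apply/andP; split; first by apply/eqP => /Kinj e; move: ra rb; rewrite e; lia.
by apply/negP => /r_mono; lia.
Qed.

(* Ordering keys c i * n + i means ordering indices by colour, then by index:
   the arrangements with increasing blocks are those with increasing keys. *)
Lemma key_inj c : injective (fun i => c i * n + i).
Proof.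
move=> i i' /(congr1 (modn^~ n)); rewrite !modnMDl !modn_small //.
exact: val_inj.
Qed.

Lemma perms3P v s j : v <= s <= n ->
  reflect (forall l m : 'I_n, l < m ->
             position_colour v s l = position_colour v s m -> j l < j m)
          (perms3 v s j).
Proof.
move=> vsn; apply: (iffP and3P) => [[h1 h2 h3] l m lm e|H].
  move: e (ltn_ord m); rewrite /position_colour => e mn.
  have h a b : increasing_between j a b -> a <= l -> m < b -> j l < j m.
    move=> /forallP/(_ l)/forallP/(_ m)/implyP h al mb.
    by apply: h; rewrite al lm.
  case: (ltnP m v) => mv; first by apply: (h _ _ h1); lia.
  case: (ltnP m s) => ms; first by apply: (h _ _ h2); lia.
  by apply: (h _ _ h3); lia.
by split; apply/forallP => l; apply/forallP => m;
  apply/implyP => /and3P[al lm mb]; apply: H => //;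
  rewrite /position_colour; lia.
Qed.

(** Both permutations list the indices by increasing key [K], and ranks then identify them. *)
Lemma perms3_uniq c v s j j' : v <= s <= n ->
  perms3 v s j -> c \o j =1 position_colour v s ->
  perms3 v s j' -> c \o j' =1 position_colour v s -> j = j'.
Proof.
move=> vsn; pose K i := c i * n + i.
have Kmono j0 : perms3 v s j0 -> c \o j0 =1 position_colour v s ->
    {homo K \o j0 : l m / l < m}.
  move=> /(perms3P _ vsn) p cj l m lm /=; rewrite /K.
  have := cj l; have := cj m => /= -> ->.
  have [e|ne] := eqVneq (position_colour v s l) (position_colour v s m).
    by have := p _ _ lm e; rewrite e; lia.
  (* Across blocks the colour grows by at least 1, so the key grows by at least [n], which outweighs
     any decrease of the index. *)
  have : position_colour v s l < position_colour v s m.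
    by move: ne; rewrite /position_colour; lia.
  have := ltn_ord (j0 l); have := ltn_ord (j0 m); nia.
move=> /Kmono h /h{}h /Kmono h' /h'{}h'; apply/permP => l.
have Kinj : injective K by exact: key_inj.
pose l' := (j'^-1)%g (j l); have jl : j' l' = j l by rewrite permKV.
have := perm_rank h' l'; rewrite jl (perm_rank h) => /val_inj e.
by rewrite -jl -e.
Qed.

(** Sort by key: colours are then nondecreasing along positions, so the numbers of colours at most 0
    and at most 1 fix where each block ends. *)
Lemma perms3_exists c v s : v <= s <= n -> (forall i, c i <= 2) ->
  #|[pred i | c i <= 0]| = v -> #|[pred i | c i <= 1]| = s ->
  exists2 j, perms3 v s j & c \o j =1 position_colour v s.
Proof.
move=> vsn c2 cv cs; pose K i := c i * n + i.
have Kinj : injective K by exact: key_inj.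
have [j Kj] := sorting_perm Kinj.
have cj_mono : {homo c \o j : l m / l <= m}.
  move=> l m; rewrite leq_eqVlt => /predU1P[/val_inj -> //|/Kj] /=; rewrite /K.
  have := ltn_ord (j l); have := ltn_ord (j m); nia.
have cj : c \o j =1 position_colour v s.
  move=> l; have /= h0 := nondecreasing_leq_card cj_mono l 0.
  have /= h1 := nondecreasing_leq_card cj_mono l 1.
  move: h0 h1 (c2 (j l)) => /=.
  by rewrite !card_perm_comp cv cs /position_colour; lia.
exists j => //; apply/(perms3P _ vsn) => l m lm e.
have := Kj _ _ lm; rewrite /= /K; have := cj l; have := cj m => /= -> ->.
by rewrite e; lia.
Qed.

Lemma card_colour v s c j : v <= s <= n -> c \o j =1 position_colour v s ->
  #|[pred i | c i <= 0]| = v /\ #|[pred i | c i <= 1]| = s.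
Proof.
move=> /andP[vs sn] cj; rewrite -!(card_perm_comp c j).
split; [rewrite -[RHS](card_ord_ltn (leq_trans vs sn))
       | rewrite -[RHS](card_ord_ltn sn)]; apply: eq_card => l;
  by rewrite !inE; have := cj l => /= ->; rewrite /position_colour; lia.
Qed.

(** An arrangement amounts to a nested pair of sets: the indices in the first [s] positions and,
    among them, those in the first [v]. *)
Lemma card_perms3 v s : v <= s <= n ->
  #|[pred j : 'S_n | perms3 v s j]| = 'C(n, s) * 'C(s, v).
Proof.
move=> vsn; have /andP[vs sn] := vsn.
pose f j : {set 'I_n} * {set 'I_n} :=
  (j @: [set l : 'I_n | l < s], j @: [set l : 'I_n | l < v]).
pose pairs := [set p : {set 'I_n} * {set 'I_n} |
  [&& #|p.1| == s, p.2 \subset p.1 & #|p.2| == v]].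
(* Colour 0 on the smaller set, 1 on the difference, 2 outside the larger set. *)
pose col (p : {set 'I_n} * {set 'I_n}) i : nat :=
  (i \notin p.2) + (i \notin p.1).
have colf j : col (f j) \o j =1 position_colour v s.
  move=> l; rewrite /col /f /= !mem_imset ?inE; try exact: perm_inj.
  by rewrite -!leqNgt.
have card_lt m : m <= n -> #|[set l : 'I_n | l < m]| = m.
  by move=> /card_ord_ltn; rewrite cardsE.
have -> : #|[pred j : 'S_n | perms3 v s j]| =
    #|f @: [set j : 'S_n | perms3 v s j]|.
  rewrite card_in_imset ?cardsE // => j j'; rewrite !inE => pj pj' e.
  by apply: (perms3_uniq (c := col (f j)) vsn) => //; rewrite e.
have -> : f @: [set j : 'S_n | perms3 v s j] = pairs.
  apply/setP => p; apply/imsetP/idP => [[j _ ->]|].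
    rewrite inE /f /= !card_imset; try exact: perm_inj.
    rewrite !card_lt ?eqxx ?andbT //=; last exact: leq_trans vs sn.
    apply: imsetS; apply/fintype.subsetP => l.
    by rewrite !inE => /leq_trans; apply.
  rewrite inE => /and3P[/eqP p1 /fintype.subsetP sub /eqP p2].
  have [|||j pj cj] := perms3_exists (c := col p) vsn.
  - by move=> i; rewrite /col; do 2!case: (_ \notin _).
  - by rewrite -p2; apply: eq_card => i; rewrite !inE /col; have := sub i;
      case: (i \in p.2); case: (i \in p.1) => //= /(_ isT).
  - by rewrite -p1; apply: eq_card => i; rewrite !inE /col; have := sub i;
      case: (i \in p.2); case: (i \in p.1) => //= /(_ isT).
  have mem i : (i \in p.2) = ((j^-1)%g i < v) /\ (i \in p.1) = ((j^-1)%g i < s).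
    have := cj ((j^-1)%g i); rewrite /= permKV /col /position_colour.
    by move: (sub i); case: (i \in p.2); case: (i \in p.1) => /=;
      [|move=> /(_ isT)| |]; lia.
  exists j; rewrite ?inE //; case: p mem {p1 sub p2 cj} => S V /= mem.
  by congr pair; apply/setP => i; rewrite -{2}(permKV j i) mem_imset ?inE;
    try exact: perm_inj; have [h2 h1] := mem i.
(* Choose the larger set [S] among all indices, then [V] inside [S]. *)
rewrite -sum1dep_card -(pair_big_dep (fun S : {set 'I_n} => #|S| == s)
  (fun S V : {set 'I_n} => (V \subset S) && (#|V| == v)) (fun _ _ => 1)) /=.
rewrite (eq_bigr (fun=> 'C(s, v))) => [|S /eqP <-]; last first.
  by rewrite sum1dep_card cards_draws.
rewrite sum_nat_const; congr (_ * _).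
by rewrite -[in RHS](card_ord n) -card_draws cardsE.
Qed.

Lemma card_perms3_fact v s : v <= s <= n ->
  #|[pred j : 'S_n | perms3 v s j]| * (v`! * (s - v)`! * (n - s)`!) = n`!.
Proof.
move=> /[dup] /andP[vs sn] /card_perms3 ->.
by rewrite -(bin_fact sn) -(bin_fact vs); lia.
Qed.

(** For [s = n] the third block is empty, so the results on three blocks also serve the events C. *)
Lemma perms2_perms3 v j : perms2 v j = perms3 v n j.
Proof.
rewrite /perms2 /perms3; congr andb; rewrite -[LHS]andbT; congr andb.
symmetry; apply/forallP => l; apply/forallP => m; apply/implyP => /and3P[].
by have := ltn_ord l; lia.
Qed.

End arrangements.

(** Once sorted, the entries at most [u] fill the first positions, so the entry at 0-based position
    [r] exceeds [u] when there are at most [r] of them. *)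
Lemma nth_sort_gt (s : seq nat) (r u : nat) : r < size s ->
  (u < nth 0 (sort leq s) r) = (count (leq^~ u) s <= r).
Proof.
move=> rs; rewrite -(count_sort leq).
have ss : sorted <=%O (sort leq s) by exact: (sort_sorted leq_total).
apply/idP/idP => [|cr].
  rewrite ltnNge; apply: contraR; rewrite -ltnNge => h.
  by have := Order.POrderTheory.nth_count_le (x := u) 0 ss h.
have := Order.TotalTheory.DualTotalTheory.nth_count_gt (x := u) 0 (i := r) ss.
by rewrite size_sort cr rs; apply.
Qed.

Import Order.TTheory GRing.Theory Num.Theory.

(** * Finite additivity, order statistics as counts, and the events as boxes *)

Section lifetime_distribution.
Local Open Scope classical_set_scope.
Local Open Scope ring_scope.
Context (d : measure_display) (Omega : measurableType d) (R : realType)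
  (P : probability Omega R).

Lemma Pr_setT : Pr P setT = 1.
Proof. by rewrite /Pr probability_setT. Qed.

Lemma Pr_partition (I : finType) (Q : pred I) (E : I -> set Omega)
    (A : set Omega) :
  (forall i, Q i -> measurable (E i)) ->
  (forall w, A w <-> exists2 i, Q i & E i w) ->
  (forall w i i', Q i -> Q i' -> E i w -> E i' w -> i = i') ->
  Pr P A = \sum_(i | Q i) Pr P (E i).
Proof.
move=> mE AE disj; have -> : A = \bigcup_(i in [set i | Q i]) E i.
  apply/seteqP; split=> w => [/AE|] [i Qi Ei]; first by exists i.
  by apply/AE; exists i.
rewrite /Pr measure_fin_bigcup //.
- rewrite sum_fine; last by move=> i Qi; apply/fin_num_measure/mE.
  rewrite (fsbigE [seq i <- index_enum I | Q i]);
    rewrite ?filter_uniq ?index_enum_uniq //.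
  - rewrite big_filter_cond; congr fine; apply: eq_bigl => i.
    by rewrite mem_setE andbb.
  - by move=> i /=; rewrite mem_filter => /andP[].
  - by move=> i Qi; rewrite mem_filter Qi mem_index_enum.
- exact: finite_finset.
- by move=> i i' /= Qi Qi' [w [Ei Ei']]; apply: (disj w).
Qed.

Section system.
Context (n : nat) (X : 'I_n -> {RV P >-> nat}) (Z : {RV P >-> nat}).

Lemma order_stat_gt (r : nat) (w : Omega) (t : nat) : (0 < r)%N ->
  (t%:R%:E < order_stat X r w)%E = (#|[pred i | (X i w <= t)%N]| < r)%N.
Proof.
move=> r0; rewrite /order_stat; case: (leqP r n) => rn; last first.
  (* The convention that the order statistic of rank above [n] is infinite agrees with the count,
     which never exceeds [n]. *)
  rewrite ltry; symmetry; apply: leq_ltn_trans rn.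
  by rewrite -[leqRHS]card_ord max_card.
rewrite lte_fin ltr_nat nth_sort_gt; last first.
  by rewrite size_map size_enum_ord; lia.
rewrite count_map -sum1_count big_enum_cond -sum1_card /=.
by rewrite (eq_bigl (fun i => (X i w <= t)%N)) => [|i]; [lia |].
Qed.

(** Common form of the events A and C. The sets [B] are attached to positions, not to components, so
    that changing [j] only permutes the components. *)
Definition box (j : 'S_n) (B : 'I_n -> set nat) (B' : set nat) : set Omega :=
  [set w | (forall l, B l (X (j l) w)) /\ B' (Z w)].

Lemma measurable_box j B B' : measurable (box j B B').
Proof.
have -> : box j B B' =
    (\bigcap_(l in [set` 'I_n]) X (j l) @^-1` B l) `&` (Z @^-1` B').
  by apply/seteqP; split=> w [] H ?; split=> // l; [move=> _|]; apply: H.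
apply: measurableI; last exact: measurable_funPTI.
by apply: fin_bigcap_measurable => // l _; exact: measurable_funPTI.
Qed.

Definition side_A (k v u t : nat) (l : 'I_n) : set nat :=
  if (l < v)%N then [set x | (x < u)%N]
  else if (l < n - k + 1)%N then [set u] else [set x | (t < x)%N].

Definition side_C (v t : nat) (l : 'I_n) : set nat :=
  if (l < v)%N then [set x | (x <= t)%N] else [set x | (t < x)%N].

Lemma event_A_box k v u t j : (v <= n - k + 1)%N ->
  event_A X Z k v u t j = box j (side_A k v u t) [set z | (t - u < z)%N].
Proof.
move=> vm; apply/seteqP; split=> w.
  move=> [[[h1 h2] h3] h4]; split=> // l; rewrite /side_A /=.
  case: (ltnP l v) => lv; first exact: h1.
  by case: (ltnP l (n - k + 1)) => lm; [apply: h2; rewrite /= lv | apply: h3].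
move=> [h h4]; split=> //; split; first split=> l /=.
- by move=> lv; have := h l; rewrite /side_A /= lv.
- by case/andP=> vl lm; have := h l; rewrite /side_A /= ltnNge vl lm.
- move=> l /= ml; have := h l; rewrite /side_A.
  by rewrite ltnNge (leq_trans vm ml) ltnNge ml.
Qed.

Lemma event_C_box v t j : event_C X v t j = box j (side_C v t) setT.
Proof.
apply/seteqP; split=> w.
  move=> [h1 h2]; split=> // l; rewrite /side_C /=.
  by case: (ltnP l v) => lv; [apply: h1 | apply: h2].
move=> [h _]; split=> l /= lv; have := h l; rewrite /side_C /=.
  by rewrite lv.
by rewrite ltnNge lv.
Qed.

(** * Outcome by outcome: the events A and C in terms of failure counts *)

Definition card_le (w : Omega) (u : nat) := #|[pred i | (X i w <= u)%N]|.
Definition card_lt (w : Omega) (u : nat) := #|[pred i | (X i w < u)%N]|.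

Lemma order_stat_fin (r : nat) (w : Omega) : (0 < r <= n)%N ->
  exists y : nat, [/\ order_stat X r w = y%:R%:E,
    forall u, (u < y)%N = (card_le w u < r)%N
    & forall u, (u <= y)%N = (card_lt w u < r)%N].
Proof.
case/andP=> r0 rn.
exists (nth 0%N (sort leq [seq X i w | i <- enum 'I_n]) r.-1).
have e : order_stat X r w =
    (nth 0%N (sort leq [seq X i w | i <- enum 'I_n]) r.-1)%:R%:E.
  by rewrite /order_stat rn.
have gt u : (u < nth 0%N (sort leq [seq X i w | i <- enum 'I_n]) r.-1)%N =
    (card_le w u < r)%N.
  by rewrite -(ltr_nat R) -lte_fin -e order_stat_gt.
(* At 0 no value is strictly smaller; at [u.+1] the claim is the one for [u < y], because
   [card_lt w u.+1] is [card_le w u]. *)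
split=> // -[|u]; last by rewrite gt.
by rewrite leq0n /card_lt eq_card0.
Qed.

(* Equals 0, 1, 2 when X i w is less than, equal to, greater than u; on event_A
   the last case means X i w > t. *)
Definition colour_A (w : Omega) (u : nat) (i : 'I_n) : nat :=
  (u <= X i w) + (u < X i w).

Lemma event_A_colour k v u t j w : (v < n - k + 1)%N -> (u <= t)%N ->
  event_A X Z k v u t j w ->
  colour_A w u \o j =1 position_colour v (n - k + 1).
Proof.
move=> vm ut; rewrite event_A_box; last exact: ltnW.
move=> [h _] l; rewrite /colour_A /= /position_colour.
have := h l; rewrite /side_A; case: (ltnP l v) => lv /=; first by lia.
by case: (ltnP l (n - k + 1)) => lm /=; lia.
Qed.

(** These counts depend on the outcome only, so they let one recover [u] and [v] from it and
    separate the events A from each other and from the events C. *)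
Lemma event_A_counts k v u t j w :
  (v < n - k + 1 <= n)%N -> (u <= t)%N -> event_A X Z k v u t j w ->
  [/\ card_lt w u = v, card_le w u = (n - k + 1)%N, card_le w t = (n - k + 1)%N
    & (t - u < Z w)%N].
Proof.
move=> /andP[vm mn] ut /[dup] Aj; rewrite event_A_box; last exact: ltnW.
move=> [h tZ].
have side i : [\/ (X i w < u)%N, X i w = u | (t < X i w)%N].
  have := h ((j^-1)%g i); rewrite permKV /side_A.
  case: ifP => _; first by constructor 1.
  by case: ifP => _; [constructor 2 | constructor 3].
have [|c0 c1] := card_colour _ (event_A_colour vm ut Aj); first by lia.
have cu : card_le w u = (n - k + 1)%N.
  by rewrite -c1; apply: eq_card => i; rewrite !inE /colour_A; lia.
split=> //.
- by rewrite -c0; apply: eq_card => i; rewrite !inE /colour_A; lia.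
- by rewrite -cu; apply: eq_card => i; rewrite !inE; case: (side i); lia.
Qed.

Lemma event_A_exists k u t w :
  (card_lt w u < n - k + 1 <= n)%N -> (u <= t)%N ->
  card_le w u = (n - k + 1)%N -> card_le w t = (n - k + 1)%N ->
  (t - u < Z w)%N ->
  exists2 j, perms3 (card_lt w u) (n - k + 1) j
           & event_A X Z k (card_lt w u) u t j w.
Proof.
move=> /andP[vm mn] ut cu ct tZ.
(* Equal counts at [u] and [t] mean that no component fails after [u] and up to [t]. *)
have gap i : (X i w <= t)%N -> (X i w <= u)%N.
  have sub : [pred i | (X i w <= u)%N] \subset [pred i | (X i w <= t)%N].
    by apply/fintype.subsetP => i'; rewrite !inE => /leq_trans; apply.
  have /subset_cardP/(_ sub)/(_ i) : card_le w u = card_le w t by rewrite cu ct.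
  by rewrite !inE => ->.
have [||||j pj cj] := @perms3_exists _ (colour_A w u) (card_lt w u) (n - k + 1).
- by lia.
- by move=> i; rewrite /colour_A; lia.
- by apply: eq_card => i; rewrite !inE /colour_A; lia.
- by rewrite -cu; apply: eq_card => i; rewrite !inE /colour_A; lia.
exists j => //; rewrite event_A_box; last exact: ltnW.
split=> // l; have := cj l; have := gap (j l).
rewrite /colour_A /= /position_colour /side_A.
case: (ltnP l (card_lt w u)) => lv /=; first by lia.
by case: (ltnP l (n - k + 1)) => lm /=; lia.
Qed.

(** Only two colours occur, 0 for failed by [t] and 1 for alive at [t], which is the case
    [s = n]. *)
Lemma event_C_colour v t j w : event_C X v t j w ->
  (fun i => (t < X i w)%N : nat) \o j =1 position_colour v n.
Proof.
rewrite event_C_box => -[h _] l; rewrite /= /position_colour.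
have := h l; have := ltn_ord l.
by rewrite /side_C; case: (ltnP l v) => lv /=; lia.
Qed.

Lemma event_C_count v t j w : (v <= n)%N ->
  event_C X v t j w -> card_le w t = v.
Proof.
move=> vn Cj.
have [|<- _] := card_colour _ (event_C_colour Cj); first by rewrite vn leqnn.
by apply: eq_card => i; rewrite !inE; lia.
Qed.

Lemma event_C_exists t w :
  exists2 j, perms2 (card_le w t) j & event_C X (card_le w t) t j w.
Proof.
have vn : (card_le w t <= n)%N by rewrite -[leqRHS]card_ord max_card.
have [||||j pj cj] :=
  @perms3_exists _ (fun i => (t < X i w)%N : nat) (card_le w t) n.
- by rewrite vn leqnn.
- by move=> i; lia.
- by apply: eq_card => i; rewrite !inE; lia.
- by rewrite -[RHS]card_ord; apply: eq_card => i; rewrite !inE; lia.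
exists j; first by rewrite perms2_perms3.
rewrite event_C_box; split=> // l; have := cj l; have := ltn_ord l.
rewrite /= /position_colour /side_C.
by case: (ltnP l (card_le w t)) => lv /=; lia.
Qed.

Lemma lifetime_gtP k t w : (0 < k <= n)%N ->
  (t%:R%:E < lifetime X Z k w)%E <->
  (exists v u j, [/\ (v < n - k + 1)%N, (u <= t)%N, perms3 v (n - k + 1) j
                   & event_A X Z k v u t j w]) \/
  (exists v j, [/\ (v < n - k + 1)%N, perms2 v j & event_C X v t j w]).
Proof.
move=> /andP[k0 kn].
(* Since [k >= 1], the order statistic of rank [n - k + 1] is a finite [y], and the first term of
   the minimum can be compared in [nat]. *)
have [|y [ey ygt yge]] := @order_stat_fin (n - k + 1) w; first by lia.
rewrite /lifetime lt_min ey -EFinD lte_fin -natrD ltr_nat.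
rewrite order_stat_gt; last by lia.
rewrite -/(card_le w t); split.
- move=> /andP[tyZ ct]; have [ltm|gem] := ltnP (card_le w t) (n - k + 1).
    by right; have [j pj Cj] := event_C_exists t w; exists (card_le w t), j.
  (* Surviving the second term of the minimum bounds the count at [t] by [n - k + 1]. *)
  have {gem}ct : card_le w t = (n - k + 1)%N by lia.
  have yt : (y <= t)%N by have := ygt t; rewrite ct; lia.
  have le_yt : (card_le w y <= card_le w t)%N.
    apply/subset_leq_card/fintype.subsetP => i.
    by rewrite !inE => /leq_trans; apply.
  (* The spare starts at [u = y], and [v] counts the failures strictly before [y]. *)
  have [|||||j pj Aj] := @event_A_exists k y t w => //.
  + by have := yge y; lia.
  + by have := ygt y; lia.
  + by lia.
  by left; exists (card_lt w y), y, j; split=> //; have := yge y; lia.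
- case=> [[v [u [j [vm ut pj]]]]|[v [j [vm pj]]]].
    move=> /event_A_counts[] //; first by lia.
    by move=> cltu _ ->; have := yge u; lia.
  by move=> /event_C_count e; have := ygt t; rewrite e //; lia.
Qed.

(** * The general formula, by additivity over the events A and C *)

Lemma lifetime_gt_prob k t : (0 < k <= n)%N ->
  Pr P [set w | (t%:R%:E < lifetime X Z k w)%E] =
    \sum_(0 <= v < (n - k).+1) \sum_(j : 'S_n | perms3 v (n - k + 1) j)
      \sum_(0 <= u < t.+1) Pr P (event_A X Z k v u t j)
    + \sum_(0 <= v < (n - k).+1) \sum_(j : 'S_n | perms2 v j)
        Pr P (event_C X v t j).
Proof.
move=> kn; have mn : (n - k + 1 <= n)%N by lia.
(* The triples [(v, j, u)] of the events A and the pairs [(v, j)] of the events C form one finite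
   index type, so a single partition yields both sums. *)
pose I1 : finType := ('I_(n - k).+1 * ('S_n * 'I_t.+1))%type.
pose I2 : finType := ('I_(n - k).+1 * 'S_n)%type.
pose Q (i : I1 + I2) := match i with
  | inl i1 => perms3 i1.1 (n - k + 1) i1.2.1
  | inr i2 => perms2 i2.1 i2.2 end.
pose E (i : I1 + I2) := match i with
  | inl i1 => event_A X Z k i1.1 i1.2.2 t i1.2.1
  | inr i2 => event_C X i2.1 t i2.2 end.
have vP (v : 'I_(n - k).+1) : (v < n - k + 1 <= n)%N.
  by rewrite mn addn1 ltn_ord.
have uP (u : 'I_t.+1) : (u <= t)%N by rewrite -ltnS.
have vn (v : 'I_(n - k).+1) : (v <= n)%N.
  by case/andP: (vP v) => /ltnW/leq_trans; apply.
rewrite (@Pr_partition _ Q E).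
- rewrite big_sumType !big_mkord /=; congr (_ + _).
    transitivity (\sum_(v < (n - k).+1)
        \sum_(q : 'S_n * 'I_t.+1 | perms3 v (n - k + 1) q.1)
          Pr P (event_A X Z k v q.2 t q.1)); first by rewrite pair_big_dep.
    apply: eq_bigr => v _; symmetry.
    transitivity (\sum_(j | perms3 v (n - k + 1) j)
        \sum_(u < t.+1) Pr P (event_A X Z k v u t j)).
      by apply: eq_bigr => j _; rewrite big_mkord.
    by rewrite pair_big_dep; apply: eq_bigl => q; rewrite andbT.
  by rewrite [RHS]pair_big_dep.
- move=> [[v [j u]]|[v j]] _ /=.
    rewrite event_A_box; first exact: measurable_box.
    by case/andP: (vP v) => /ltnW.
  by rewrite event_C_box; exact: measurable_box.
- move=> w; split.
    move=> /(lifetime_gtP t w kn).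
    case=> [[v [u [j [vm ut pj Aj]]]]|[v [j [vm pj Cj]]]].
      have v1 : (v < (n - k).+1)%N by lia.
      by exists (inl (Ordinal v1, (j, Ordinal (ut : (u < t.+1)%N)))).
    have v1 : (v < (n - k).+1)%N by lia.
    by exists (inr (Ordinal v1, j)).
  case=> [[[v [j u]]|[v j]] /= pj Ej]; apply/(lifetime_gtP t w kn).
    by left; exists v, u, j; split=> //; case/andP: (vP v).
  by right; exists v, j; split=> //; case/andP: (vP v).
- move=> w [[v [j u]]|[v j]] [[v' [j' u']]|[v' j']] /= pj pj' Ej Ej'.
  + have [lt le tt _] := event_A_counts (vP v) (uP u) Ej.
    have [lt' le' tt' _] := event_A_counts (vP v') (uP u') Ej'.
    have le_lt a b : (a < b)%N -> (card_le w a <= card_lt w b)%N.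
      move=> ab; apply/subset_leq_card/fintype.subsetP => i.
      by rewrite !inE => /leq_ltn_trans; apply.
    (* If [u < u'], the [n - k + 1] components failed by [u] would all have failed strictly before
       [u'], yet only [v' < n - k + 1] did; symmetrically for [u' < u]. *)
    have uu : u = u'.
      apply: val_inj => /=.
      have /andP[vm _] := vP v; have /andP[vm' _] := vP v'.
      by case: (ltngtP u u') => // /le_lt; lia.
    subst u'; have vv : v = v' by apply: val_inj; rewrite /= -lt -lt'.
    subst v'; congr (inl (_, (_, _))); have /andP[vm _] := vP v.
    apply: perms3_uniq pj _ pj' _; last first.
    - exact: event_A_colour vm (uP u) Ej'.
    - exact: event_A_colour vm (uP u) Ej.
    by rewrite mn (ltnW vm).
  (* The count at [t] is [n - k + 1] on an event A but smaller on an event C. *)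
  + have [_ _ tt _] := event_A_counts (vP v) (uP u) Ej.
    by have := event_C_count (vn v') Ej'; have := vP v'; lia.
  + have [_ _ tt _] := event_A_counts (vP v') (uP u') Ej'.
    by have := event_C_count (vn v) Ej; have := vP v; lia.
  + have e := event_C_count (vn v) Ej; have e' := event_C_count (vn v') Ej'.
    have vv : v = v' by apply: val_inj; rewrite /= -e -e'.
    subst v'; congr (inr (_, _)); rewrite !perms2_perms3 in pj pj'.
    apply: perms3_uniq pj (event_C_colour Ej) pj' (event_C_colour Ej').
    by rewrite vn leqnn.
Qed.

(** * Probabilities of boxes under exchangeability and under independence *)

Lemma box_exchangeable j B B' :
  exchangeable (with_standby X Z) -> Pr P (box j B B') = Pr P (box 1%g B B').
Proof.
move=> exch; pose C : set (n.+1.-tuple nat) :=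
  (\bigcap_(l in [set: 'I_n]) (fun x => tnth x (lift ord_max l)) @^-1` B l)
  `&` (fun x => tnth x ord_max) @^-1` B'.
have mC : measurable C.
  have m (i : 'I_n.+1) (D : set nat) :
      measurable ((fun x : n.+1.-tuple nat => tnth x i) @^-1` D).
    by rewrite -[_ @^-1` _]setTI; exact: measurable_tnth.
  apply: measurableI; last exact: m.
  by apply: fin_bigcap_measurable => // l _; exact: m.
have boxE (i : 'S_n) : P (box i B B') = P (box 1%g B B').
  (* Extend the permutation of the components to all [n.+1] coordinates by fixing the last one,
     which carries the standby unit. *)
  have := exch (lift_perm ord_max ord_max i) C mC; rewrite /pushforward => e.
  transitivity (P (random_vector (fun l => with_standby X Z
     (lift_perm ord_max ord_max i l)) @^-1` C)).
    congr (P _); apply/seteqP; split=> w [h hZ]; split.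
    - by move=> l _; rewrite /= tnth_mktuple lift_perm_lift /with_standby liftK.
    - by rewrite /= tnth_mktuple lift_perm_id /with_standby unlift_none.
    - move=> l; have := h l I.
      by rewrite /= tnth_mktuple lift_perm_lift /with_standby liftK.
    - move: hZ.
      by rewrite /= tnth_mktuple lift_perm_id /with_standby unlift_none.
  rewrite e; congr (P _); apply/seteqP; split=> w [h hZ]; split.
  - move=> l; have := h l I.
    by rewrite /= tnth_mktuple /with_standby liftK perm1.
  - by move: hZ; rewrite /= tnth_mktuple /with_standby unlift_none.
  - move=> l _; have := h l.
    by rewrite /= tnth_mktuple /with_standby liftK perm1.
  - by rewrite /= tnth_mktuple /with_standby unlift_none.
by rewrite /Pr boxE.
Qed.

Lemma box_independent j B B' : mutually_independent (with_standby X Z) ->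
  Pr P (box j B B') =
  (\prod_l Pr P (X (j l) @^-1` B l)) * Pr P (Z @^-1` B').
Proof.
move=> indep.
(* Position [l] constrains component [j l], so component [i] must lie in the set attached to
   position [j^-1 i]; the last coordinate gets [B']. *)
pose C (i : 'I_n.+1) :=
  if unlift ord_max i is Some l then B ((j^-1)%g l) else B'.
have -> : box j B B' =
    \bigcap_(i in [set i | i \in [set: 'I_n.+1]%SET])
      (with_standby X Z i @^-1` C i).
  apply/seteqP; split=> w.
    move=> [h hZ] i _; rewrite /= /with_standby /C.
    case: unliftP => [l _|//]; have := h ((j^-1)%g l); by rewrite permKV.
  move=> h; split=> [l|].
    have := h (lift ord_max (j l)); rewrite /= /with_standby /C liftK permK.
    by apply; rewrite inE.
  have := h ord_max; rewrite /= /with_standby /C unlift_none.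
  by apply; rewrite inE.
rewrite indep // (eq_bigl xpredT) => [|i]; last by rewrite inE.
rewrite (bigD1_ord ord_max) //= mulrC; congr (_ * _); last first.
  by rewrite /with_standby /C unlift_none.
rewrite (reindex_inj (@perm_inj _ j)) /=; apply: eq_bigr => l _.
by rewrite /with_standby /C liftK permK.
Qed.

(** Factor in two stages: first [Z] from the whole vector, then the components from each other. *)
Lemma box_independent2 j B B' :
  independent2 P (random_vector X) Z -> mutually_independent X ->
  Pr P (box j B B') =
  (\prod_l Pr P (X (j l) @^-1` B l)) * Pr P (Z @^-1` B').
Proof.
move=> indepZ indep; pose C : set (n.-tuple nat) :=
  \bigcap_(l in [set: 'I_n]) (fun x => tnth x (j l)) @^-1` B l.
have mC : measurable C.
  apply: fin_bigcap_measurable => // l _.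
  by rewrite -[_ @^-1` _]setTI; exact: measurable_tnth.
have -> : box j B B' = random_vector X @^-1` C `&` Z @^-1` B'.
  apply/seteqP; split=> w [h hZ]; split=> //.
    by move=> l _; rewrite /= tnth_mktuple.
  by move=> l; have := h l I; rewrite /= tnth_mktuple.
rewrite indepZ //; congr (_ * _).
have -> : random_vector X @^-1` C =
    \bigcap_(i in [set i | i \in [set: 'I_n]%SET]) (X i @^-1` B ((j^-1)%g i)).
  apply/seteqP; split=> w h.
    by move=> i _; have := h ((j^-1)%g i) I; rewrite /= tnth_mktuple permKV.
  move=> l _; rewrite /= tnth_mktuple.
  by have := h (j l); rewrite /= permK; apply; rewrite inE.
rewrite indep // (eq_bigl xpredT) => [|i]; last by rewrite inE.
rewrite (reindex_inj (@perm_inj _ j)) /=; apply: eq_bigr => l _.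
by rewrite permK.
Qed.

Lemma prod_side_A (Y : 'I_n -> {RV P >-> nat}) k v u t : (v <= n - k + 1)%N ->
  \prod_l Pr P (Y l @^-1` side_A k v u t l) =
  (\prod_(l < n | (l < v)%N) F_lt (Y l) u)
  * (\prod_(l < n | (v <= l < n - k + 1)%N) p_eq (Y l) u)
  * (\prod_(l < n | (n - k + 1 <= l)%N) F_gt (Y l) t).
Proof.
move=> vm; rewrite (bigID (fun l : 'I_n => (l < v)%N)) /= -mulrA; congr (_ * _).
  by apply: eq_bigr => l lv; rewrite /side_A lv.
rewrite (bigID (fun l : 'I_n => (l < n - k + 1)%N)) /=; congr (_ * _).
  apply: eq_big => [l|l /andP[/negbTE lv lm]]; first by rewrite -leqNgt.
  by rewrite /side_A lv lm.
apply: eq_big => [l|l /andP[/negbTE lv /negbTE lm]]; first by lia.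
by rewrite /side_A lv lm.
Qed.

Lemma prod_side_C (Y : 'I_n -> {RV P >-> nat}) v t :
  \prod_l Pr P (Y l @^-1` side_C v t l) =
  (\prod_(l < n | (l < v)%N) F_le (Y l) t)
  * (\prod_(l < n | (v <= l)%N) F_gt (Y l) t).
Proof.
rewrite (bigID (fun l : 'I_n => (l < v)%N)) /=; congr (_ * _).
  by apply: eq_bigr => l lv; rewrite /side_C lv.
apply: eq_big => [l|l /negbTE lv]; first by rewrite -leqNgt.
by rewrite /side_C lv.
Qed.

(** * Product formulas for A and C from the factorization that both independence assumptions
    provide *)

Section product_form.
Context (box_prod : forall j B B', Pr P (box j B B') =
  (\prod_l Pr P (X (j l) @^-1` B l)) * Pr P (Z @^-1` B')).

Lemma Pr_event_A k v u t j : (v <= n - k + 1)%N ->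
  Pr P (event_A X Z k v u t j) =
  (\prod_(l < n | (l < v)%N) F_lt (X (j l)) u)
  * (\prod_(l < n | (v <= l < n - k + 1)%N) p_eq (X (j l)) u)
  * (\prod_(l < n | (n - k + 1 <= l)%N) F_gt (X (j l)) t)
  * F_gt Z (t - u).
Proof.
by move=> vm; rewrite event_A_box // box_prod (prod_side_A (fun l => X (j l))).
Qed.

Lemma Pr_event_C v t j :
  Pr P (event_C X v t j) =
  (\prod_(l < n | (l < v)%N) F_le (X (j l)) t)
  * (\prod_(l < n | (v <= l)%N) F_gt (X (j l)) t).
Proof.
rewrite event_C_box box_prod (prod_side_C (fun l => X (j l))).
by rewrite preimage_setT Pr_setT mulr1.
Qed.

End product_form.

(** Shared by the exchangeable and the i.i.d. cases: when box probabilities do not depend on [j],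
    each sum over arrangements is their number times the term of the identity. *)
Lemma lifetime_gt_prob_invariant k t : (0 < k <= n)%N ->
  (forall j B B', Pr P (box j B B') = Pr P (box 1%g B B')) ->
  Pr P [set w | (t%:R%:E < lifetime X Z k w)%E] =
    n`!%:R * \sum_(0 <= v < (n - k).+1)
      (v`!%:R)^-1 *
      (((n - k + 1 - v)`!%:R * (k - 1)`!%:R)^-1
         * (\sum_(0 <= u < t.+1) Pr P (event_A X Z k v u t 1%g))
       + ((n - v)`!%:R)^-1 * Pr P (event_C X v t 1%g)).
Proof.
move=> kn inv; rewrite lifetime_gt_prob // -big_split mulr_sumr.
apply: eq_big_nat => v /andP[_ vk] /=.
have fact_neq0 m : m`!%:R != 0 :> R by rewrite pnatr_eq0 -lt0n fact_gt0.
have sumA : \sum_(j : 'S_n | perms3 v (n - k + 1) j)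
      \sum_(0 <= u < t.+1) Pr P (event_A X Z k v u t j) =
    #|[pred j : 'S_n | perms3 v (n - k + 1) j]|%:R
    * \sum_(0 <= u < t.+1) Pr P (event_A X Z k v u t 1%g).
  rewrite mulr_natl -sumr_const; apply: eq_bigr => j _; apply: eq_bigr => u _.
  by rewrite !event_A_box; [exact: inv | lia | lia].
have sumC : \sum_(j : 'S_n | perms2 v j) Pr P (event_C X v t j) =
    #|[pred j : 'S_n | perms3 v n j]|%:R * Pr P (event_C X v t 1%g).
  rewrite mulr_natl -sumr_const; apply: eq_big => j; first exact: perms2_perms3.
  by move=> _; rewrite !event_C_box; exact: inv.
(* The three blocks have sizes [v], [n - k + 1 - v] and [k - 1]; for C below the last block is
   empty. *)
have cA : n`!%:R = #|[pred j : 'S_n | perms3 v (n - k + 1) j]|%:R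
    * (v`!%:R * (n - k + 1 - v)`!%:R * (k - 1)`!%:R) :> R.
  have /card_perms3_fact <- : (v <= n - k + 1 <= n)%N by lia.
  by rewrite !natrM (_ : n - (n - k + 1) = k - 1)%N //; lia.
have cC : n`!%:R = #|[pred j : 'S_n | perms3 v n j]|%:R
    * (v`!%:R * (n - v)`!%:R) :> R.
  have /card_perms3_fact <- : (v <= n <= n)%N by lia.
  by rewrite !natrM subnn fact0 mulr1.
rewrite sumA sumC !mulrDr; congr (_ + _); [rewrite cA | rewrite cC]; field.
  by rewrite !fact_neq0.
by rewrite !fact_neq0.
Qed.

Lemma prod_const_range (c : R) a b : (b <= n)%N ->
  \prod_(l < n | (a <= l < b)%N) c = c ^+ (b - a).
Proof.
move=> bn; rewrite -(big_mkord (fun l => a <= l < b)%N (fun=> c)).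
rewrite -prodr_const_nat (big_nat_widen _ _ _ _ _ bn).
rewrite [RHS](big_nat_widenl _ 0) //.
by apply: eq_bigl => l; rewrite andbC.
Qed.

Lemma prod_const_tail (c : R) a :
  \prod_(l < n | (a <= l)%N) c = c ^+ (n - a).
Proof.
by rewrite -prod_const_range //; apply: eq_bigl => l; rewrite ltn_ord andbT.
Qed.

End system.
End lifetime_distribution.

(** * The general formula and its three specializations *)

Local Open Scope classical_set_scope.
Local Open Scope ring_scope.

Theorem theorem2p1 (d : measure_display) (Omega : measurableType d)
    (R : realType) (P : probability Omega R) (n k : nat)
    (hk : (1 <= k <= n)%N)
    (X : 'I_n -> {RV P >-> nat}) (Z : {RV P >-> nat}) (t : nat) :
  [/\ Pr P [set w | (t%:R%:E < lifetime X Z k w)%E] =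
        \sum_(0 <= v < (n - k).+1) \sum_(j : 'S_n | perms3 v (n - k + 1) j)
          \sum_(0 <= u < t.+1) Pr P (event_A X Z k v u t j)
        + \sum_(0 <= v < (n - k).+1) \sum_(j : 'S_n | perms2 v j)
            Pr P (event_C X v t j),
      mutually_independent (with_standby X Z) ->
      Pr P [set w | (t%:R%:E < lifetime X Z k w)%E] =
        \sum_(0 <= v < (n - k).+1)
          (\sum_(j : 'S_n | perms3 v (n - k + 1) j)
             (\prod_(l < n | (n - k + 1 <= l)%N) F_gt (X (j l)) t)
             * \sum_(0 <= u < t.+1)
                 (\prod_(l < n | (l < v)%N) F_lt (X (j l)) u)
                 * (\prod_(l < n | (v <= l < n - k + 1)%N) p_eq (X (j l)) u)
                 * F_gt Z (t - u)
           + \sum_(j : 'S_n | perms2 v j)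
               (\prod_(l < n | (l < v)%N) F_le (X (j l)) t)
               * (\prod_(l < n | (v <= l)%N) F_gt (X (j l)) t)),
      exchangeable (with_standby X Z) ->
      Pr P [set w | (t%:R%:E < lifetime X Z k w)%E] =
        n`!%:R * \sum_(0 <= v < (n - k).+1)
          (v`!%:R)^-1 *
          (((n - k + 1 - v)`!%:R * (k - 1)`!%:R)^-1
             * (\sum_(0 <= u < t.+1) Pr P (event_A X Z k v u t 1%g))
           + ((n - v)`!%:R)^-1 * Pr P (event_C X v t 1%g))
    & independent2 P (random_vector X) Z ->
      mutually_independent X ->
      (forall i i' : 'I_n, same_distribution P (X i) (X i')) ->
      (* the common distribution is that of X i, for any i *)
      forall i : 'I_n,
      Pr P [set w | (t%:R%:E < lifetime X Z k w)%E] =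
        n`!%:R * \sum_(0 <= v < (n - k).+1)
          (v`!%:R)^-1 *
          (F_gt (X i) t ^+ (k - 1)
             / ((n - k + 1 - v)`!%:R * (k - 1)`!%:R)
             * (\sum_(0 <= u < t.+1)
                  F_lt (X i) u ^+ v * p_eq (X i) u ^+ (n - k + 1 - v)
                  * F_gt Z (t - u))
           + ((n - v)`!%:R)^-1
             * (F_le (X i) t ^+ v * F_gt (X i) t ^+ (n - v)))].
Proof.
have main := lifetime_gt_prob X Z t hk.
split=> //.
- move=> /box_independent indep; rewrite main -big_split.
  apply: eq_big_nat => v /andP[_ vk] /=; congr (_ + _).
    apply: eq_bigr => j _; rewrite mulr_sumr; apply: eq_bigr => u _.
    by rewrite (Pr_event_A indep) ?addn1 1?ltnW //; ring.
  by apply: eq_bigr => j _; rewrite (Pr_event_C indep).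
- move=> exch; apply: lifetime_gt_prob_invariant => // j B B'.
  exact: box_exchangeable.
- move=> indepZ indep ident i.
  have box_prod j B B' := box_independent2 j B B' indepZ indep.
  have same l D : Pr P (X l @^-1` D) = Pr P (X i @^-1` D).
    by rewrite /Pr; congr fine; exact: (ident l i D).
  (* With identical marginals the factors of a box no longer depend on [j], so the formula with the
     identity arrangement applies. *)
  have inv j B B' : Pr P (box X Z j B B') = Pr P (box X Z 1%g B B').
    rewrite !box_prod; congr (_ * _); apply: eq_bigr => l _.
    by rewrite same [RHS]same.
  rewrite lifetime_gt_prob_invariant //; congr (_ * _).
  apply: eq_big_nat => v /andP[_ vk]; congr (_ * (_ + _ * _)).
    (* Isolate the inverse factorials, then move the power of [F_gt (X i) t] inside the sum over [u]
       to compare term by term. *)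
    rewrite -[RHS]mulrA [RHS]mulrCA; congr (_ * _).
    rewrite mulr_sumr; apply: eq_bigr => u _.
    rewrite (Pr_event_A box_prod); last by lia.
    rewrite (eq_bigr (fun=> F_lt (X i) u)) => [|l _];
      last exact: (same _ [set x | (x < u)%N]).
    rewrite [X in _ * X * _ * _](eq_bigr (fun=> p_eq (X i) u)) => [|l _];
      last exact: (same _ [set u]).
    rewrite [X in _ * X * _](eq_bigr (fun=> F_gt (X i) t)) => [|l _];
      last exact: (same _ [set x | (t < x)%N]).
    rewrite (prod_const_range _ 0); last by lia.
    rewrite prod_const_range ?prod_const_tail; last by lia.
    rewrite subn0 (_ : n - (n - k + 1) = k - 1)%N; last by lia.
    ring.
  rewrite (Pr_event_C box_prod).
  rewrite (eq_bigr (fun=> F_le (X i) t)) => [|l _];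
    last exact: (same _ [set x | (x <= t)%N]).
  rewrite [X in _ * X](eq_bigr (fun=> F_gt (X i) t)) => [|l _];
    last exact: (same _ [set x | (t < x)%N]).
  by rewrite (prod_const_range _ 0) ?prod_const_tail ?subn0 //; lia.
Qed.
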